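(* Let $\mathbb Z_{2,3}$ be the subring of $\mathbb Q$ consisting of the rational numbers whose reduced expression $\frac mn$ has $n$ neither even nor a multiple of $3$. Then $\mathbb Z_{2,3}$ has finitely many maximal ideals, the identity automorphism of $\mathbb Z_{2,3}$ is positively expansive, but $\mathbb Z_{2,3}$ has no $\prec$-minimal generator (that is, the identity is not $0$-expansive).
   Context: A generator of a commutative unital ring $R$ is a finite set $\mathcal I$ of ideals of $R$ with $\sum_{I\in\mathcal I}I=R$. The product of generators is $\mathcal I\mathcal J=\{IJ\mid I\in\mathcal I,\,J\in\mathcal J\}$, and similarly for finitely many factors. For families of sets, $\mathcal A\prec\mathcal B$ means that for every $A\in\mathcal A$ there is $B\in\mathcal B$ with $A\subseteq B$. A generator $\mathcal I$ is $\prec$-minimal if $\mathcal I\prec\mathcal J$ for every generator $\mathcal J$; the existence of a $\prec$-minimal generator of $R$ is called $0$-expansivity of (any automorphism of) $R$. For an automorphism $\alpha$ of $R$ and $i\in\mathbb Z$, $\alpha^{i}(\mathcal I)=\{\alpha^{i}(I)\mid I\in\mathcal I\}$. The automorphism $\alpha$ is positively expansive if there is a generator $\mathcal I$ such that for every generator $\mathcal J$ there is $N\ge0$ with $\prod_{i=0}^N\alpha^{-i}(\mathcal I)\prec\mathcal J$. *)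

(* Defs.v *)
From HB Require Import structures.
From mathcomp Require Import all_boot all_order all_algebra.
From mathcomp Require Import mathcomp_extra boolp classical_sets functions.
From mathcomp Require Import cardinality.

Set Implicit Arguments.
Unset Strict Implicit.
Unset Printing Implicit Defensive.

Import Order.TTheory GRing.Theory Num.Theory.
Local Open Scope classical_set_scope.
Local Open Scope ring_scope.

(* ring_quotient's idealr_closed is not used: it only covers proper ideals
   given by boolean predicates, while the whole ring must count as an ideal
   here. *)
Definition is_ideal (R : comPzRingType) (I : set R) : Prop :=
  [/\ I 0,
      forall x y, I x -> I y -> I (x + y)
    & forall a x, I x -> I (a * x)].

Definition is_maximal_ideal (R : comPzRingType) (M : set R) : Prop :=
  [/\ is_ideal M, M <> setT
    & forall J : set R, is_ideal J -> M `<=` J -> J = M \/ J = setT].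

(* The sum of a family of ideals: finite sums of elements, each taken in some
   member of the family. *)
Definition ideal_sum (R : comPzRingType) (G : set (set R)) : set R :=
  [set x | exists (n : nat) (a : 'I_n -> R),
     (forall k, exists2 I, G I & I (a k)) /\ x = \sum_(k < n) a k].

Definition ideal_mul (R : comPzRingType) (I J : set R) : set R :=
  [set x | exists (n : nat) (a b : 'I_n -> R),
     [/\ forall k, I (a k), forall k, J (b k) & x = \sum_(k < n) a k * b k]].

Definition generator (R : comPzRingType) (G : set (set R)) : Prop :=
  [/\ finite_set G, forall I, G I -> is_ideal I & ideal_sum G = setT].

Definition gen_mul (R : comPzRingType) (G H : set (set R)) : set (set R) :=
  [set ideal_mul I J | I in G & J in H].

Definition prec (T : Type) (A B : set (set T)) : Prop :=
  forall X, A X -> exists2 Y, B Y & X `<=` Y.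

Definition prec_minimal_generator (R : comPzRingType) (G : set (set R)) :=
  generator G /\ forall H : set (set R), generator H -> prec G H.

Record ring_aut (R : comPzRingType) := RingAut {
  aut_fun :> {rmorphism R -> R};
  aut_inv : R -> R;
  aut_funK : cancel aut_fun aut_inv;
  aut_invK : cancel aut_inv aut_fun
}.

Definition id_aut (R : comPzRingType) : ring_aut R :=
  @RingAut R idfun idfun (fun=> erefl) (fun=> erefl).

Definition aut_exp (R : comPzRingType) (alpha : ring_aut R) (i : int) : R -> R :=
  match i with
  | Posz n => iter n alpha
  | Negz n => iter n.+1 (aut_inv alpha)
  end.

Definition gen_image (R : comPzRingType) (alpha : ring_aut R) (i : int)
    (G : set (set R)) : set (set R) :=
  [set aut_exp alpha i @` I | I in G].

(* The iterated product starts from the generator {R}, which is neutral since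
   I R = I for every ideal I. *)
Definition positively_expansive (R : comPzRingType) (alpha : ring_aut R) :=
  exists2 G : set (set R), generator G &
    forall H : set (set R), generator H ->
      exists N : nat,
        prec (\big[@gen_mul R/[set setT]]_(0 <= i < N.+1)
                gen_image alpha (- i%:Z) G) H.

(* denq x is the positive denominator of the reduced expression of x. *)
Definition Z23_pred : {pred rat} :=
  [pred x | ~~ (2 %| denq x)%Z && ~~ (3 %| denq x)%Z].

Lemma Z23_predP (x : rat) :
  reflect (exists2 d : int, ~~ (2 %| d)%Z && ~~ (3 %| d)%Z
                          & x * d%:~R \is a Num.int)
          (x \in Z23_pred).
Proof.
apply: (iffP idP) => [x23|[d /andP[d2 d3] /intrP[m xd]]].
  by exists (denq x); rewrite // -numqE intr_int.
have dvd_d : (denq x %| d)%Z.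
  have: numq x * d = m * denq x.
    by apply/eqP; rewrite -(eqr_int rat) !intrM numqE -xd mulrAC.
  move=> e; have: (denq x %| numq x * d)%Z by rewrite e dvdz_mull.
  by rewrite Gauss_dvdzr // coprimezE coprime_sym coprime_num_den.
by apply/andP; split; [apply: contra d2|apply: contra d3] => /dvdz_trans; apply.
Qed.

Lemma Z23_pred_subring : subring_closed Z23_pred.
Proof.
have primeM (d e : int) : ~~ (2 %| d)%Z && ~~ (3 %| d)%Z ->
    ~~ (2 %| e)%Z && ~~ (3 %| e)%Z ->
    ~~ (2 %| d * e)%Z && ~~ (3 %| d * e)%Z.
  rewrite !dvdzE !abszM !Euclid_dvdM //.
  by move=> /andP[/negPf-> /negPf->] /andP[/negPf-> /negPf->].
split=> [|x y /Z23_predP[d d23 xd] /Z23_predP[e e23 ye]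
         |x y /Z23_predP[d d23 xd] /Z23_predP[e e23 ye]].
- by apply/Z23_predP; exists 1; rewrite // mulr1 rpred1.
- apply/Z23_predP; exists (d * e); rewrite ?primeM // intrM mulrBl.
  by rewrite mulrA [y * _]mulrCA rpredB //; apply: rpredM => //; exact: intr_int.
- apply/Z23_predP; exists (d * e); rewrite ?primeM // intrM mulrACA.
  by rewrite rpredM.
Qed.

HB.instance Definition _ :=
  GRing.isSubringClosed.Build rat Z23_pred Z23_pred_subring.

Record Z23 := MkZ23 { Z23_val :> rat; _ : Z23_val \in Z23_pred }.

HB.instance Definition _ := [isSub for Z23_val].
HB.instance Definition _ := [Choice of Z23 by <:].
HB.instance Definition _ := [SubChoice_isSubComNzRing of Z23 by <:].

(* Main.v *)
(** The maximal ideals of Z23 are 2R and 3R, since an element outside both is a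
    unit.  A generator H has a member I not contained in 2R and a member J not
    contained in 3R; up to a unit, an element of I outside 2R is a power of 3,
    so 3^k is in I and likewise 2^l is in J.  The products of k + l + 1 ideals
    taken in {2R, 3R} are the 2^a 3^b R with a + b = k + l + 1, hence a >= l or
    b >= k, and each of them lies in I or J.  Finally, a minimal generator would
    precede every {2^n R, 3^n R}; but a nonzero x lies in neither 2^n R nor
    3^n R for n large, so all members of that generator would be zero. *)

Require Import Defs.
From mathcomp Require Import all_boot all_algebra.
From mathcomp Require Import boolp classical_sets cardinality.
From mathcomp Require Import ring.

Set Implicit Arguments.
Unset Strict Implicit.
Unset Printing Implicit Defensive.

Import GRing.Theory Num.Theory.
Local Open Scope classical_set_scope.
Local Open Scope ring_scope.

(** * Ideals and generators in an arbitrary commutative ring *)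

Section PrincipalIdeals.
Variable R : comPzRingType.
Implicit Types (a b x : R) (G : set (set R)) (I J : set R).

Definition principal a : set R := [set x | exists y, x = a * y].

Lemma principal_ideal a : is_ideal (principal a).
Proof.
split=> [|x y [u ->] [v ->]|c x [u ->]]; first by exists 0; rewrite mulr0.
- by exists (u + v); rewrite mulrDr.
- by exists (c * u); rewrite mulrCA.
Qed.

Lemma principal_sub I a : is_ideal I -> I a -> principal a `<=` I.
Proof. by move=> [_ _ IM] Ia x [y ->]; rewrite mulrC; apply: IM. Qed.

Lemma ideal_sum_sub G J :
  is_ideal J -> (forall I, G I -> I `<=` J) -> ideal_sum G `<=` J.
Proof.
move=> [J0 JD _] GJ x [n [a [aG ->]]].
by apply: big_ind => // k _; have [I GI] := aG k; apply: GJ.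
Qed.

Lemma ideal_mul_sub I J a b :
  I `<=` principal a -> J `<=` principal b ->
  ideal_mul I J `<=` principal (a * b).
Proof.
move=> Ia Jb x [n [u [v [uI vJ ->]]]]; have [p0 pD _] := principal_ideal (a * b).
apply: big_ind => // k _; have [y ->] := Ia _ (uI k); have [z ->] := Jb _ (vJ k).
by exists (y * z); rewrite mulrACA.
Qed.

Lemma ideal_unit I x y : is_ideal I -> I x -> x * y = 1 -> I = setT.
Proof.
move=> [_ _ IM] Ix xy; apply/seteqP; split=> // z _.
have -> : z = z * y * x by rewrite -mulrA [y * x]mulrC xy mulr1.
exact: IM.
Qed.

(** Were all members of [G] inside [J], so would be their sum, which is the whole ring. *)
Lemma generator_not_sub G J :
  generator G -> is_ideal J -> J <> setT ->
  exists I x, [/\ G I, I x & ~ J x].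
Proof.
move=> [_ _ Gsum] Jid JT; apply: contrapT => noI; apply: JT.
apply/seteqP; split=> // x _.
have: ideal_sum G x by rewrite Gsum.
apply: ideal_sum_sub => // I GI y Iy; apply: contrapT => nJy.
by apply: noI; exists I, y.
Qed.

(** Bezout's identity over the integers, mapped into [R], splits every [x] into a multiple of [m]
    plus a multiple of [n]. *)
Lemma coprime_generator (m n : nat) :
  coprime m n -> generator [set principal m%:R; principal n%:R].
Proof.
move=> mn; split; first exact: finite_set2.
  by move=> I [->|->]; apply: principal_ideal.
apply/seteqP; split=> // x _.
have [[u v] /= uv] := coprimezP m%:Z n%:Z mn.
pose a (k : 'I_2) : R :=
  if k == ord0 then m%:R * (u%:~R * x) else n%:R * (v%:~R * x).
exists 2, a; split=> [k|].
  rewrite /a; case: eqP => _.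
    by exists (principal m%:R); [left|exists (u%:~R * x)].
  by exists (principal n%:R); [right|exists (v%:~R * x)].
rewrite big_ord_recl big_ord1 /a /= !mulrA -mulrDl.
have /(congr1 (fun z : int => z%:~R : R)) := uv.
rewrite rmorphD !rmorphM /= rmorph1 [_ * u%:~R]mulrC [_ * v%:~R]mulrC => ->.
by rewrite mul1r.
Qed.

Lemma aut_exp_id (i : int) : aut_exp (id_aut R) i =1 id.
Proof. by case: i => n x; [|rewrite /aut_exp]; elim: n => //= n ->. Qed.

Lemma gen_image_id (i : int) G : gen_image (id_aut R) i G = G.
Proof.
have imE I : aut_exp (id_aut R) i @` I = I.
  apply/seteqP; split=> [_ [x Ix <-]|x Ix]; first by rewrite aut_exp_id.
  by exists x => //; rewrite aut_exp_id.
apply/seteqP; split=> [_ [I GI <-]|I GI]; first by rewrite imE.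
by exists I => //; rewrite imE.
Qed.

(** By induction on [n]: each factor contributes one [a] or one [b], and the empty product, the
    whole ring, is generated by [a ^+ 0 * b ^+ 0]. *)
Lemma prec_power_pair a b (n : nat) (X : set R) :
  (\big[@gen_mul R/[set setT]]_(0 <= i < n)
     [set principal a; principal b]) X ->
  exists i j, (i + j)%N = n /\ X `<=` principal (a ^+ i * b ^+ j).
Proof.
elim: n X => [|n IHn] X.
  rewrite big_nil => ->; exists 0%N, 0%N; split=> // x _.
  by exists x; rewrite !mul1r.
rewrite big_nat_recl // => -[I abI [J /IHn[i [j [ijn Jij]]] <-]].
case: abI => ->.
- exists i.+1, j; split; first by rewrite addSn ijn.
  by rewrite exprS -mulrA; apply: ideal_mul_sub.
- exists i, j.+1; split; first by rewrite addnS ijn.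
  by rewrite exprS mulrCA; apply: ideal_mul_sub.
Qed.

End PrincipalIdeals.

(** * Divisibility, units and generators in [Z23] *)

Section Z23.
Implicit Types (k p : nat) (x y : Z23).

(** Denominators in [Z23] are prime to [p], so divisibility by a power of [p] can be read off the
    numerator. *)
Lemma Z23_principalP p k x : p \in [:: 2; 3] ->
  reflect (principal (p%:R ^+ k) x) (p%:Z ^+ k %| numq (val x))%Z.
Proof.
move=> p23.
have p0 : (p%:R ^+ k : rat) != 0.
  by rewrite expf_neq0 // pnatr_eq0; move: p23; rewrite !inE => /orP[]/eqP->.
apply: (iffP idP) => [/dvdzP[q xq]|[y xy]].
- have y23 : val x / p%:R ^+ k \in Z23_pred.
    apply/Z23_predP; exists (denq (val x)); first exact: valP x.
    rewrite mulrAC -numqE xq rmorphM rmorphXn /= mulfK //.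
  exists (MkZ23 y23); apply: val_inj.
  by rewrite rmorphM rmorphXn rmorph_nat /= mulrC divfK.
- have vx : val x = p%:R ^+ k * val y by rewrite xy rmorphM rmorphXn rmorph_nat.
  have e : numq (val x) * denq (val y)
      = p%:Z ^+ k * (numq (val y) * denq (val x)).
    apply/eqP; rewrite -(eqr_int rat) !rmorphM rmorphXn /= !numqE.
    by rewrite {1}vx mulrAC !mulrA.
  have: (p%:Z ^+ k %| numq (val x) * denq (val y))%Z by rewrite e dvdz_mulr.
  rewrite Gauss_dvdzl // coprimezXl // coprimezE absz_nat.
  have /andP[] := valP y; rewrite !dvdzE => y2 y3.
  by move: p23; rewrite !inE => /orP[]/eqP->; rewrite prime_coprime.
Qed.

Lemma Z23_principal1P p x : p \in [:: 2; 3] ->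
  reflect (principal p%:R x) (p%:Z %| numq (val x))%Z.
Proof. by move=> /(Z23_principalP 1 x); rewrite !expr1. Qed.

(** The numerator of [x] is then prime to 6, and it serves as a denominator for the inverse. *)
Lemma Z23_unit x : ~ principal 2%:R x -> ~ principal 3%:R x ->
  exists y, x * y = 1.
Proof.
move=> x2 x3.
have n23 : ~~ (2 %| numq (val x))%Z && ~~ (3 %| numq (val x))%Z.
  by apply/andP; split; apply/negP => d; [apply: x2|apply: x3];
    apply/Z23_principal1P.
have x0 : val x != 0 by apply/eqP => e; move: n23; rewrite e.
have y23 : (val x)^-1 \in Z23_pred.
  by apply/Z23_predP; exists (numq (val x)); rewrite // numqE mulKf // intr_int.
by exists (MkZ23 y23); apply: val_inj; rewrite rmorphM rmorph1 /= mulfV.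
Qed.

Lemma Z23_not_principal p : p \in [:: 2; 3] -> ~ principal p%:R (1 : Z23).
Proof.
move=> p23 /(Z23_principal1P _ p23).
by move: p23; rewrite !inE => /orP[]/eqP->.
Qed.

(** Here [k] is the [p]-adic valuation of the numerator. The cofactor [u] serves positive
    expansivity; the last clause serves to exclude a minimal generator. *)
Lemma Z23_prime_power_factor p x : p \in [:: 2; 3] -> x != 0 ->
  exists k u, [/\ x = p%:R ^+ k * u, ~ principal p%:R u
    & ~ principal (p%:R ^+ k.+1) x].
Proof.
move=> p23 x0; pose n := `|numq (val x)|%N.
have n0 : (0 < n)%N by rewrite absz_gt0 numq_eq0 (inj_eq val_inj x 0).
have pr : prime p by move: p23; rewrite !inE => /orP[]/eqP->.
have xP k : principal (p%:R ^+ k) x <-> (k <= logn p n)%N.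
  rewrite -pfactor_dvdn //; split.
    by move=> /(Z23_principalP _ _ p23); rewrite dvdzE abszX.
  by move=> d; apply/(Z23_principalP _ _ p23); rewrite dvdzE abszX.
have [u xu] := (xP (logn p n)).2 (leqnn _).
have xk : ~ principal (p%:R ^+ (logn p n).+1) x by rewrite xP ltnn.
exists (logn p n), u; split=> // -[y uy]; apply: xk.
by exists y; rewrite xu uy exprSr mulrA.
Qed.

Lemma Z23_principal_proper p : p \in [:: 2; 3] ->
  principal (p%:R : Z23) <> setT.
Proof. by move=> p23 pT; apply: (Z23_not_principal p23); rewrite pT. Qed.

Lemma Z23_maximal_ideal (M : set Z23) :
  is_maximal_ideal M -> M = principal 2%:R \/ M = principal 3%:R.
Proof.
move=> [Mid MT Mmax]; have [_ MD MM] := Mid.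
have max p : p \in [:: 2; 3] -> M `<=` principal p%:R -> M = principal p%:R.
  move=> p23 Mp; have [//|/Z23_principal_proper] := Mmax _ (principal_ideal _) Mp.
  by move/(_ p23).
have [M2|/existsNP[x /not_implyP[Mx x2]]] := pselect (M `<=` principal 2%:R).
  by left; apply: max.
have [M3|/existsNP[y /not_implyP[My y3]]] := pselect (M `<=` principal 3%:R).
  by right; apply: max.
(* This element of [M] is congruent to [x] modulo 2 and to [- y] modulo 3, so it avoids both
   principal ideals and is a unit. *)
have [] := @Z23_unit (3%:R * x + 2%:R * y).
- move=> [z e]; apply: x2; exists (z - x - y).
  by rewrite !mulrBr -e; ring.
- move=> [z e]; apply: y3; exists (x + y - z).
  by rewrite !mulrBr -e; ring.
by move=> z e; case: MT; apply: ideal_unit Mid _ e; apply: MD; apply: MM.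
Qed.

(** The [perm_eq] hypothesis treats both orders of 2 and 3 at once. *)
Lemma Z23_generator_power p q (G : set (set Z23)) :
  perm_eq [:: p; q] [:: 2; 3] -> generator G ->
  exists k I, G I /\ principal (q%:R ^+ k) `<=` I.
Proof.
move=> pq Ggen; have [_ Gid _] := Ggen.
have p23 : p \in [:: 2; 3] by rewrite -(perm_mem pq) mem_head.
have q23 : q \in [:: 2; 3] by rewrite -(perm_mem pq) !inE eqxx orbT.
have [I [x [GI Ix xp]]] :=
  generator_not_sub Ggen (principal_ideal _) (Z23_principal_proper p23).
have x0 : x != 0.
  by apply/eqP => e; apply: xp; exists 0; rewrite mulr0.
have [k [u [xu uq _]]] := Z23_prime_power_factor q23 x0.
(* Since [u] divides [x], it avoids the ideal of [p] as well as that of [q], which makes it a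
   unit. *)
have up : ~ principal p%:R u.
  by move=> [v e]; apply: xp; exists (q%:R ^+ k * v); rewrite xu e mulrCA.
have [v uv] : exists v, u * v = 1.
  have: (p == 2) && (q == 3) || (p == 3) && (q == 2).
    by move: p23 q23 pq; rewrite !inE => /orP[]/eqP-> /orP[]/eqP->.
  by case/orP=> /andP[/eqP pE /eqP qE]; move: up uq; rewrite pE qE => *;
    apply: Z23_unit.
exists k, I; split=> //; apply: principal_sub; first exact: Gid.
have [_ _ IM] := Gid _ GI.
have -> : q%:R ^+ k = v * x by rewrite xu mulrCA [v * u]mulrC uv mulr1.
exact: IM.
Qed.

Lemma Z23_expansive : positively_expansive (id_aut Z23).
Proof.
exists [set principal 2%:R; principal 3%:R]; first exact: coprime_generator.
move=> H Hgen.
have [l [J [HJ lJ]]] := @Z23_generator_power 3 2 H isT Hgen.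
have [k [I [HI kI]]] := @Z23_generator_power 2 3 H isT Hgen.
(* Indices run from 0 to [N] inclusive, so this choice of [N] gives [k + l + 1] factors. *)
exists (k + l)%N => X.
under eq_bigr do rewrite gen_image_id.
move=> /prec_power_pair[a [b [ab Xab]]].
have powS (c d : Z23) i j : (i <= j)%N ->
    principal (c ^+ j * d) `<=` principal (c ^+ i).
  move=> ij _ [y ->]; exists (c ^+ (j - i) * d * y).
  by rewrite !mulrA -exprD subnKC.
have [la|al] := leqP l a.
  by exists J => // x /Xab /(powS _ _ _ _ la) /lJ.
(* With [a < l], the equation [a + b = k + l + 1] forces [k <= b]. *)
exists I => // x /Xab; rewrite mulrC => /powS xk; apply/kI/xk.
have: (k + l < l + b)%N by rewrite -ab leq_add2r ltnW.
by rewrite addnC ltn_add2l => /ltnW.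
Qed.

Lemma Z23_no_minimal_generator (G : set (set Z23)) : ~ prec_minimal_generator G.
Proof.
move=> [Ggen Gmin].
have z0 : is_ideal [set (0 : Z23)].
  split=> // [x y -> ->|a x ->]; first exact: addr0.
  exact: mulr0.
(* The zero ideal is proper, so some member of [G] contains a nonzero [x]. *)
have [|I [x [GI Ix /eqP x0]]] := generator_not_sub Ggen z0.
  by move=> e; have: [set (0 : Z23)] 1 by [rewrite e]; apply/eqP/oner_neq0.
have [//|k [_ [_ _ x2]]] := @Z23_prime_power_factor 2 x _ x0.
have [//|l [_ [_ _ x3]]] := @Z23_prime_power_factor 3 x _ x0.
(* The exponents exceed the 2-adic and 3-adic valuations of [x] by one, so [x] lies in neither
   ideal. *)
have mgen : generator [set principal ((2 ^ k.+1)%N%:R : Z23);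
                           principal ((3 ^ l.+1)%N%:R)].
  by apply: coprime_generator; rewrite coprimeXl // coprimeXr.
have [_ [->|->] /(_ x Ix)] := Gmin _ mgen I GI; by rewrite natrX.
Qed.

End Z23.

Theorem mainTheorem5 :
  [/\ finite_set [set M : set Z23 | is_maximal_ideal M]%classic,
      positively_expansive (id_aut Z23)
    & ~ (exists G : set (set Z23), prec_minimal_generator G)].
Proof.
split; last by move=> [G /Z23_no_minimal_generator].
- by apply: sub_finite_set Z23_maximal_ideal _; apply: finite_set2.
- exact: Z23_expansive.
Qed.
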